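(* For each integer $n\ge 0$, let $a_n$ denote the number of tilings of a $7\times 8n$ board by $L$-tetrominoes (rotations allowed, reflections not allowed). Then the generating function is $\sum_{n\ge 0}a_nt^n=-A(t)/B(t)$, where \begin{align*} A(t) &= 54 t^{25}-2805 t^{24}+61114 t^{23}-437586 t^{22}+756220 t^{21}-1683407 t^{20}+201818 t^{19}\\ &\qquad -4732871 t^{18}+5812686 t^{17}+6513779 t^{16}-5791118 t^{15}-15036852 t^{14}\\ &\qquad-14634004 t^{13} -854802 t^{12}+887014 t^{11}-5043234 t^{10}-3069842 t^{9}+558740 t^{8}\\ &\qquad +642802 t^{7}+30014 t^{6}-18954 t^{5}-2525 t^{4}-486 t^{3}-168 t^{2}-16 t +1 , \end{align*} and \begin{align*} B(t) &= 3 t^{26}-572 t^{25}+20037 t^{24}-299100 t^{23}+1278161 t^{22}-3054798 t^{21}+5765025 t^{20}\\ &\qquad -3431380 t^{19} +23400340 t^{18}-15270754 t^{17}-4408598 t^{16}-17388698 t^{15}\\ &\qquad +20834748 t^{14}+39814896 t^{13}+28440798 t^{12}+16183108 t^{11}+10581385 t^{10}\\ &\qquad +6300318 t^{9}-880287 t^{8}-1336202 t^{7}-197778 t^{6}-1116 t^{5}-48 t^{4}\\ &\qquad +356 t^{3}+259 t^{2}+30 t -1 . \end{align*} The first terms of the sequence $(a_n)_{n\ge 0}$ are $1, 14, 511, 18826, 699540, 26023308, 968374240, 36035363996, \ldots$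
   Context: A $k\times n$ board is the rectangle of unit cells $\{(x,y)\in\mathbb{Z}^2: 0\le x<n,\ 0\le y<k\}$, where each cell is named by its bottom left corner. The $L$-tetromino tiles are the translates of the four sets (the rotations of the $L$-tetromino) \[\{(0,0),(0,1),(0,2),(1,0)\},\ \{(0,0),(0,1),(1,1),(2,1)\},\ \{(0,0),(1,0),(2,0),(2,1)\},\ \{(0,2),(1,0),(1,1),(1,2)\}.\] Reflections of these shapes are not allowed. A tiling of a board is a partition of its set of cells into such tiles (each tile may be used any number of times); two tilings are the same only if they are equal as partitions of the board (no identification under symmetries). The empty board ($n=0$) has exactly one tiling. Generating functions are formal power series in $t$ with rational coefficients. *)

(* Defs.v *)
(* Stdlib's binary integers serve only to write large numerals. *)
From Stdlib Require Import ZArith.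
From mathcomp Require Import all_boot all_order all_algebra ssrZ.

Set Implicit Arguments.
Unset Strict Implicit.
Unset Printing Implicit Defensive.

Import Order.TTheory GRing.Theory Num.Theory.
Local Open Scope ring_scope.

(* MathComp has rebound %Z to int_scope, whose numerals are unary. *)
Delimit Scope Z_scope with ZZ.

(* Cells of the k x n board (k rows, n columns): the pair (x, y) has
   x : 'I_n and y : 'I_k. *)
Definition cell (k n : nat) : finType := ('I_n * 'I_k)%type.

Definition pos (k n : nat) (c : cell k n) : int * int := (c.1%:Z, c.2%:Z).

Definition cells := seq (int * int).

Definition L_tetrominoes : seq cells :=
  [:: [:: (0, 0); (0, 1); (0, 2); (1, 0)];
      [:: (0, 0); (0, 1); (1, 1); (2, 1)];
      [:: (0, 0); (1, 0); (2, 0); (2, 1)];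
      [:: (0, 2); (1, 0); (1, 1); (1, 2)]].

Definition translate (d : int * int) (s : cells) : cells := [seq p + d | p <- s].

(* The set of positions of D is the translate of s by d; both lists are
   duplicate-free, so perm_eq is equality of sets. *)
Definition is_translate (k n : nat) (D : {set cell k n}) (s : cells)
    (d : int * int) : bool :=
  perm_eq [seq pos c | c <- enum D] (translate d s).

(* The translation vector is the lower left corner of the bounding box, hence
   may be taken among the cells of the board; see is_tileP. *)
Definition is_tile (k n : nat) (D : {set cell k n}) : bool :=
  [exists d : cell k n, has (fun s => is_translate D s (pos d)) L_tetrominoes].

Lemma is_tileP (k n : nat) (D : {set cell k n}) :
  reflect (exists s, s \in L_tetrominoes /\ exists d, is_translate D s d)
          (is_tile D).
Proof.
apply: (iffP existsP) => [[d /hasP[s sL sd]]|[s [sL [d sd]]]].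
  by exists s; split=> //; exists (pos d).
have onB p : p \in s -> exists c : cell k n, pos c = p + d.
  move=> ps; have: p + d \in translate d s by apply: map_f.
  by rewrite -(perm_mem sd) => /mapP[c _ ->]; exists c.
have [p ps p0] : exists2 p, p \in s & p.1 = 0.
  have /allP/(_ s sL)/hasP[p ps /eqP] :
    all (has (fun p : int * int => p.1 == 0)) L_tetrominoes by [].
  by exists p.
have [q qs q0] : exists2 q, q \in s & q.2 = 0.
  have /allP/(_ s sL)/hasP[q qs /eqP] :
    all (has (fun q : int * int => q.2 == 0)) L_tetrominoes by [].
  by exists q.
have [c /(congr1 fst) c1] := onB p ps; have [e /(congr1 snd) e2] := onB q qs.
exists (c.1, e.2); apply/hasP; exists s => //.
rewrite (_ : pos _ = d) // /pos /=.
move: c1 e2; rewrite /= p0 q0 !add0r => -> ->; by case: (d).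
Qed.

Definition is_tiling (k n : nat) (P : {set {set cell k n}}) : bool :=
  partition P [set: cell k n] && [forall D in P, is_tile D].

Definition num_tilings (k n : nat) : nat :=
  #|[set P : {set {set cell k n}} | is_tiling P]|.

(* Formal power series, as coefficient sequences; equality is =1. *)
Definition fps (F : fieldType) := nat -> F.

Section PowerSeries.
Variable F : fieldType.
Implicit Types f g : fps F.

Definition fps_of_poly (p : {poly F}) : fps F := fun m => p`_m.

Definition fps_one : fps F := fps_of_poly 1.

Definition fps_opp f : fps F := fun m => - f m.

Definition fps_mul f g : fps F := fun m => \sum_(i < m.+1) f i * g (m - i)%N.

(* First m coefficients of 1 / f, obtained by solving f * g = 1 degree by
   degree. *)
Fixpoint fps_inv_coefs f (m : nat) : seq F :=
  if m is m'.+1 then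
    let s := fps_inv_coefs f m' in
    rcons s (((m' == 0%N)%:R - \sum_(i < m') f (m' - i)%N * s`_i) / f 0%N)
  else [::].

(* Meaningful when the constant term of f is nonzero; see fps_mulfV. *)
Definition fps_inv f : fps F := fun m => (fps_inv_coefs f m.+1)`_m.

Definition fps_div f g : fps F := fps_mul f (fps_inv g).

Lemma size_fps_inv_coefs f m : size (fps_inv_coefs f m) = m.
Proof. by elim: m => //= m IHm; rewrite size_rcons IHm. Qed.

Lemma nth_fps_inv_coefs f m i :
  (i < m)%N -> (fps_inv_coefs f m)`_i = fps_inv f i.
Proof.
elim: m => // m IHm; rewrite ltnS leq_eqVlt => /predU1P[->//|ltim].
by rewrite /= nth_rcons size_fps_inv_coefs ltim IHm.
Qed.

Lemma fps_invE f m :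
  fps_inv f m =
    ((m == 0%N)%:R - \sum_(i < m) f (m - i)%N * fps_inv f i) / f 0%N.
Proof.
rewrite {1}/fps_inv /= nth_rcons size_fps_inv_coefs ltnn eqxx.
by under eq_bigr => i _ do rewrite nth_fps_inv_coefs //.
Qed.

Lemma fps_mulfV f : f 0%N != 0 -> fps_mul f (fps_inv f) =1 fps_one.
Proof.
move=> f0 m; rewrite /fps_one /fps_of_poly coef1 /fps_mul.
rewrite (reindex_inj rev_ord_inj) /=.
under eq_bigr => i _ do rewrite subSS subKn -1?ltnS //.
by rewrite big_ord_recr /= subnn (fps_invE f m) mulrCA mulfV // mulr1 subrKC.
Qed.

End PowerSeries.

Definition a_ (n : nat) : nat := num_tilings 7 (8 * n).

Definition tilings_gf : fps rat := fun n => (a_ n)%:R.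

(* Coefficients are listed by decreasing degree, none being omitted. *)
Definition poly_of_coefs (s : seq Z) : {poly rat} :=
  Poly [seq (int_of_Z c)%:~R | c <- rev s].

Definition A_poly : {poly rat} := poly_of_coefs [::
  54; -2805; 61114; -437586; 756220; -1683407; 201818;
  -4732871; 5812686; 6513779; -5791118; -15036852;
  -14634004; -854802; 887014; -5043234; -3069842; 558740;
  642802; 30014; -18954; -2525; -486; -168; -16; 1]%ZZ.

Definition B_poly : {poly rat} := poly_of_coefs [::
  3; -572; 20037; -299100; 1278161; -3054798; 5765025;
  -3431380; 23400340; -15270754; -4408598; -17388698;
  20834748; 39814896; 28440798; 16183108; 10581385;
  6300318; -880287; -1336202; -197778; -1116; -48;
  356; 259; 30; -1]%ZZ.

(* Hence B_poly is invertible as a power series. *)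
Lemma B_poly0 : fps_of_poly B_poly 0 = -1.
Proof. by rewrite /fps_of_poly /B_poly /poly_of_coefs coef_Poly. Qed.

(* Main.v *)
(* The cells of the 7-row board are ordered column by column.  In a tiling of a
   region, the tile through the first free cell is one of four translates with
   that cell as first cell, so tilings are counted by a transfer matrix whose
   states record which of the next few cells are already used.  Let w_m be the
   vector of weights of the states reached after 8m columns of a board with
   7 rows (fewer than a hundred of them are nonzero).  Then a_(m+q) is a linear
   functional, depending only on q, evaluated at w_m.  Writing b_j for the
   coefficients of B, one checks that sum_j b_j w_(27-j) = 0 (the corresponding
   combination of w_0, ..., w_26 is not zero), which gives the recurrence for
   n >= 27; the coefficients of B * sum_n a_n t^n below 27 are computed. *)
Require Import Defs.
From Stdlib Require Import ZArith.
From mathcomp Require Import all_boot all_order all_algebra ssrZ zify.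

Set Implicit Arguments.
Unset Strict Implicit.
Unset Printing Implicit Defensive.

Import Order.TTheory GRing.Theory Num.Theory.

(** * Encoded tiles and the transfer step on tries *)

(* A tile is encoded by the least and greatest row its first cell may have on a
   7-row board, and by the offsets of its cells from the first one when the cell
   (x, y) is numbered 7 x + y. *)
Definition tiles : seq (nat * nat * seq nat) :=
  [:: (0, 4, [:: 0; 1; 2; 7]); (0, 5, [:: 0; 1; 8; 15]);
      (0, 5, [:: 0; 7; 14; 15]); (2, 6, [:: 0; 5; 6; 7])].

Definition fits_row (y : nat) (t : nat * nat * seq nat) := t.1.1 <= y <= t.1.2.

(** Offset 0 is left out: it is the cell being filled, which leaves the state. *)
Definition tail_mask (o : seq nat) : seq bool :=
  mkseq (fun j => j.+1 \in o) (last 0 o).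

Definition tails (y : nat) : seq (seq bool) :=
  [seq tail_mask t.2 | t <- tiles & fits_row y t].

(* Row of the first of the last K cells. *)
Definition row_of (K : nat) := 6 - K %% 7.

(* Formal Z-linear combinations of states.  A state is the list of used/free
   flags of the next cells, up to trailing free ones; Node l r branches on the
   first flag, free in l and used in r, and Leaf v is v times the state with all
   flags free. *)
Inductive trie := Leaf of Z | Node of trie & trie.

Definition is_empty (t : trie) := if t is Leaf Z0 then true else false.

(** Zero leaves are collapsed so that [place] prunes dead branches at once. *)
Definition node (l r : trie) :=
  if is_empty l && is_empty r then Leaf Z0 else Node l r.

Definition free_part (t : trie) := if t is Node l _ then l else t.
Definition used_part (t : trie) := if t is Node _ r then r else Leaf Z0.

Fixpoint place (p : seq bool) (t : trie) : trie :=
  if is_empty t then t else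
  if p is b :: p' then
    if b then node (Leaf Z0) (place p' (free_part t))
    else node (place p' (free_part t)) (place p' (used_part t))
  else t.

Fixpoint add_free (v : Z) (t : trie) : trie :=
  match t with
  | Leaf w => Leaf (Z.add v w)
  | Node l r => Node (add_free v l) r
  end.

Fixpoint merge (t u : trie) : trie :=
  match t, u with
  | Leaf v, _ => add_free v u
  | _, Leaf v => add_free v t
  | Node l r, Node l' r' => Node (merge l l') (merge r r')
  end.

Fixpoint scale (c : Z) (t : trie) : trie :=
  match t with
  | Leaf v => Leaf (Z.mul c v)
  | Node l r => Node (scale c l) (scale c r)
  end.

(** [merge] may cancel weights without collapsing nodes, so every leaf is tested. *)
Fixpoint null (t : trie) : bool :=
  match t with
  | Leaf v => Z.eqb v Z0
  | Node l r => null l && null r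
  end.

(** At the end of the board only the state with all flags free is a tiling. *)
Fixpoint weight0 (t : trie) : Z :=
  match t with Leaf v => v | Node l _ => weight0 l end.

Definition step (y : nat) (t : trie) : trie :=
  foldr (fun p u => merge (place p (free_part t)) u) (used_part t) (tails y).

Fixpoint run (K : nat) (t : trie) : trie :=
  if K is K'.+1 then run K' (step (row_of K') t) else t.

(** 56 cells are 8 columns; the 28 entries are w_0, ..., w_27. *)
Definition states := traject (run 56) (Leaf 1%ZZ) 28.

Definition A_coefs := [::
  54; -2805; 61114; -437586; 756220; -1683407; 201818;
  -4732871; 5812686; 6513779; -5791118; -15036852;
  -14634004; -854802; 887014; -5043234; -3069842; 558740;
  642802; 30014; -18954; -2525; -486; -168; -16; 1]%ZZ.

Definition B_coefs := [::
  3; -572; 20037; -299100; 1278161; -3054798; 5765025;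
  -3431380; 23400340; -15270754; -4408598; -17388698;
  20834748; 39814896; 28440798; 16183108; 10581385;
  6300318; -880287; -1336202; -197778; -1116; -48;
  356; 259; 30; -1]%ZZ.

Definition combine (cs : seq Z) (ts : seq trie) : trie :=
  foldr (fun ct u => merge (scale ct.1 ct.2) u) (Leaf Z0) (zip cs ts).

(** * Counting completions and evaluating tries *)

Fixpoint clash (p s : seq bool) : bool :=
  if p is b :: p' then b && head false s || clash p' (behead s) else false.

Fixpoint overlay (p s : seq bool) : seq bool :=
  if p is b :: p' then (b || head false s) :: overlay p' (behead s) else s.

(* Number of ways to tile the free ones among the last K cells; the recursion
   lets tiles stick out of the end of the board, and the base case discards
   these. *)
Fixpoint completions (K : nat) (s : seq bool) : nat :=
  if K is K'.+1 then
    if head false s then completions K' (behead s)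
    else \sum_(p <- tails (row_of K'))
           if clash p (behead s) then 0 else completions K' (overlay p (behead s))
  else ~~ has id s.

(** [merge] aligns a leaf with a node by extending its state with free flags, so it is compatible
    with functions insensitive to trailing free flags. *)
Definition padded (f : seq bool -> nat) := forall s, f (rcons s false) = f s.

(** The linear extension of [f] from states to their formal combinations. *)
Fixpoint eval (t : trie) (f : seq bool -> nat) : Z :=
  match t with
  | Leaf v => v * (f [::])%:R
  | Node l r => eval l (f \o cons false) + eval r (f \o cons true)
  end%R.

Lemma clash_rcons p s : clash p (rcons s false) = clash p s.
Proof. by elim: p s => [|b p IHp] [|a s] //=; rewrite IHp. Qed.

Lemma padded_overlay f p : padded f -> padded (f \o overlay p).
Proof.
elim: p f => [|b p IHp] f fP s; first exact: fP.
have cfP a : padded ((f \o cons a) \o overlay p).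
  by apply: IHp => s'; exact: (fP (a :: s')).
by case: s => [|a s] //; exact: cfP.
Qed.

Lemma padded_cons f b : padded f -> padded (f \o cons b).
Proof. by move=> fP s; exact: (fP (b :: s)). Qed.

Lemma padded_completions K : padded (completions K).
Proof.
elim: K => [|K IHK] s /=; first by rewrite has_rcons.
have cP p : padded (fun s => if clash p s then 0 else completions K (overlay p s)).
  by move=> s'; rewrite clash_rcons; case: ifP => // _; exact: (padded_overlay p IHK s').
by case: s => [|[] s] //=; apply: eq_bigr => p _; exact: cP.
Qed.

Lemma eq_eval t f g : f =1 g -> eval t f = eval t g.
Proof.
by elim: t f g => /= [v|l IHl r IHr] f g fg;
  rewrite ?fg // (IHl _ _ (fun s => fg (_ :: s))) (IHr _ _ (fun s => fg (_ :: s))).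
Qed.

Lemma eval_empty t f : is_empty t -> eval t f = 0%R.
Proof. by case: t => [[]|]. Qed.

Lemma eval0 t : eval t (fun=> 0) = 0%R.
Proof. by elim: t => /= [v|l IHl r IHr]; rewrite ?mulr0 // IHl IHr. Qed.

Lemma evalD t f g : eval t (fun s => f s + g s) = (eval t f + eval t g)%R.
Proof.
elim: t f g => /= [v|l IHl r IHr] f g; first by rewrite natrD mulrDr.
by rewrite [X in (X + _)%R]IHl [X in (_ + X)%R]IHr addrACA.
Qed.

Lemma eval_node l r f :
  eval (node l r) f = (eval l (f \o cons false) + eval r (f \o cons true))%R.
Proof. by rewrite /node; case: andP => //= -[l0 r0]; rewrite !eval_empty ?addr0. Qed.

Lemma eval_place p t f :
  eval (place p t) f = eval t (fun s => if clash p s then 0 else f (overlay p s)).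
Proof.
elim: p t f => [|b p IHp] t f.
  by rewrite /=; case: t => [[]|].
rewrite /=; case: ifP => [t0|_]; first by rewrite !eval_empty.
case: b; case: t => [v|l r]; rewrite eval_node /= ?IHp ?mul0r ?add0r ?addr0 //.
by rewrite [X in (_ + X)%R]eval0 addr0.
Qed.

Lemma eval_add_free v t f : padded f ->
  eval (add_free v t) f = (v * (f [::])%:R + eval t f)%R.
Proof.
elim: t f => [w|l IHl r IHr] f fP /=; first by rewrite -mulrDl.
by rewrite IHl ?addrA /= ?(fP [::]) //; apply: padded_cons.
Qed.

Lemma eval_merge t u f : padded f -> eval (merge t u) f = (eval t f + eval u f)%R.
Proof.
elim: t u f => [v|l IHl r IHr] [w|l' r'] f fP; rewrite ?eval_add_free //.
- by rewrite addrC.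
- by rewrite /= IHl ?IHr 1?addrACA //; apply: padded_cons.
Qed.

Lemma eval_scale c t f : eval (scale c t) f = (c * eval t f)%R.
Proof.
by elim: t f => /= [v|l IHl r IHr] f; rewrite ?mulrA // IHl IHr mulrDr.
Qed.

Lemma eval_null t f : null t -> eval t f = 0%R.
Proof.
elim: t f => /= [v|l IHl r IHr] f; first by move/Z.eqb_eq->; rewrite mul0r.
by move=> /andP[/IHl-> /IHr->]; rewrite addr0.
Qed.

(** [step] is the transpose of the recursion of [completions]: a cell is dealt with either in the
    state or in the functional. *)
Lemma eval_step K t :
  eval (step (row_of K) t) (completions K) = eval t (completions K.+1).
Proof.
(* A leaf stands for a state whose first flag is free, so its used part is zero. *)
have -> : eval t (completions K.+1) =
  (eval (free_part t) (completions K.+1 \o cons false) +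
   eval (used_part t) (completions K.+1 \o cons true))%R.
  case: t => [v|l r] //=; rewrite mul0r addr0; congr (_ * _%:R)%R.
rewrite -[X in (_ + X)%R]/(eval (used_part t) (completions K)).
rewrite (@eq_eval (free_part t) _ (fun s => \sum_(p <- tails (row_of K))
  if clash p s then 0 else completions K (overlay p s))) // /step addrC.
elim: (tails _) => [|p ps IHps] /=.
  by rewrite (@eq_eval (free_part t) _ (fun=> 0)) ?eval0 ?addr0 // => s; rewrite big_nil.
rewrite eval_merge; last exact: padded_completions.
rewrite IHps eval_place addrCA -evalD; congr (_ + _)%R.
by apply: eq_eval => s; rewrite big_cons.
Qed.

(** Rows depend on the number of cells left only modulo 7, so [M] further cells, being whole
    columns, do not shift them. *)
Lemma eval_run K M t : 7 %| M ->
  eval (run K t) (completions M) = eval t (completions (K + M)).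
Proof.
move=> M7; elim: K t => //= K IHK t; rewrite IHK.
by rewrite (_ : row_of K = row_of (K + M)) ?eval_step // /row_of -(modnDmr K) (eqP M7) addn0.
Qed.

(** * Recursion for partitions into admissible blocks *)

Section SetPartitions.
Variables (T : finType) (Q : pred {set T}).
Implicit Types (U D : {set T}) (P : {set {set T}}).

Definition num_partitions U :=
  #|[set P | partition P U && [forall D in P, Q D]]|.

Lemma num_partitions0 : num_partitions set0 = 1.
Proof.
rewrite /num_partitions (_ : [set _ | _] = [set set0]) ?cards1 //.
apply/setP=> P; rewrite !inE partition_set0.
by case: eqP => //= ->; apply/forall_inP => D; rewrite inE.
Qed.

(** Partitions are sorted by the block [D] of [u]; deleting that block is a bijection onto the
    partitions of [U :\: D]. *)
Lemma num_partitions_rec U u : u \in U ->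
  num_partitions U =
    \sum_(D : {set T} | [&& Q D, u \in D & D \subset U]) num_partitions (U :\: D).
Proof.
move=> uU; rewrite /num_partitions -sum1_card.
rewrite (partition_big (pblock^~ u)
           (fun D : {set T} => [&& Q D, u \in D & D \subset U])); last first.
  move=> P; rewrite inE => /andP[PU /forall_inP PQ].
  have uP : u \in cover P by rewrite (cover_partition PU).
  rewrite PQ ?pblock_mem // mem_pblock uP /= -(cover_partition PU).
  exact: bigcup_sup (pblock_mem uP).
apply: eq_bigr => D /and3P[QD uD DU].
have D0 : D != set0 by apply/set0Pn; exists u.
rewrite sum1_card -(card_in_imset (f := fun P => P :\ D)); last first.
  have DP P : partition P U -> pblock P u == D -> D \in P.
    by move=> PU /eqP <-; rewrite pblock_mem // (cover_partition PU).
  move=> P P' /andP[+ PD] /andP[+ PD'].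
  rewrite !inE => /andP[PU _] /andP[PU' _] /(congr1 (setU [set D])).
  by rewrite !setD1K ?DP.
apply: eq_card => P; apply/imsetP/idP => [[P' + ->]|].
  rewrite unfold_in !inE => /andP[/andP[PU /forall_inP PQ] /eqP PD].
  have DP : D \in P' by rewrite -PD pblock_mem // (cover_partition PU).
  rewrite partitionD1 //=; apply/forall_inP => E /setD1P[_]; exact: PQ.
rewrite !inE => /andP[PU /forall_inP PQ].
have PU' : partition (D |: P) U.
  rewrite -[U](setID _ D) (setIidPr DU) partitionU1 //.
  by rewrite -setI_eq0 setDE setICA setICr setI0.
exists (D |: P).
  rewrite unfold_in !inE PU' /=; apply/andP; split.
    by apply/forall_inP => E /setU1P[->//|]; exact: PQ.
  by apply/eqP; rewrite (def_pblock _ (setU11 _ _)) //; case/and3P: PU'.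
(* As [u] lies in [D], [D] is no block of a partition of [U :\: D]. *)
rewrite setU1K //; apply/negP => DP.
by have := subsetP (partitionS PU DP) u uD; rewrite inE uD.
Qed.

End SetPartitions.

(** * Tiles of the board in terms of cell ranks *)

Section Board.
Variable N : nat.
Implicit Types (c : cell 7 N) (D : {set cell 7 N}).

Definition rank c : nat := c.1 * 7 + c.2.

Lemma ltn_rank c : rank c < 7 * N.
Proof. by case: c => [[x ?] [y ?]]; rewrite /rank /=; lia. Qed.

Lemma rank_surj p : p < 7 * N -> exists c, rank c = p.
Proof.
move=> ltp; have ltx : p %/ 7 < N by lia.
by exists (Ordinal ltx, Ordinal (ltn_pmod p (isT : 0 < 7))); rewrite /rank /=; lia.
Qed.

Definition tile_at (p : nat) (o : seq nat) : {set cell 7 N} :=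
  [set c | rank c \in [seq p + i | i <- o]].

Lemma pos_inj : injective (@pos 7 N).
Proof. by move=> [x y] [x' y'] [/val_inj-> /val_inj->]. Qed.

Definition shifted (d : nat * nat) (q : nat * nat) c :=
  (c.1 == q.1 + d.1 :> nat) && (c.2 == q.2 + d.2 :> nat).

(** The first condition excludes shapes cut off by the border; natural coordinates bring the rest
    within reach of [lia]. *)
Lemma is_translateP D (s : seq (nat * nat)) (d : cell 7 N) : uniq s ->
  is_translate D [seq (q.1%:Z, q.2%:Z)%R | q <- s] (pos d) <->
  (forall q, q \in s -> exists c, shifted (d.1 : nat, d.2 : nat) q c) /\
  (forall c, (c \in D) = has ((shifted (d.1 : nat, d.2 : nat))^~ c) s).
Proof.
pose to_int (q : nat * nat) := (q.1%:Z, q.2%:Z)%R.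
have posE (c : cell 7 N) q :
    (pos c == to_int q + pos d)%R = shifted (d.1 : nat, d.2 : nat) q c by [].
have memE c : (pos c \in translate (pos d) (map to_int s)) =
    has ((shifted (d.1 : nat, d.2 : nat))^~ c) s.
  rewrite /translate -map_comp; apply/mapP/hasP => -[q qs H]; exists q => //.
    by rewrite -posE; apply/eqP.
  by apply/eqP; rewrite posE.
move=> s_uniq; split=> [sd|[onB memD]].
  split=> [q qs|c]; last first.
    by rewrite -memE -(perm_mem sd) mem_map ?mem_enum //; exact: pos_inj.
  have : (to_int q + pos d)%R \in translate (pos d) (map to_int s).
    by do 2!apply: map_f.
  by rewrite -(perm_mem sd) => /mapP[c _ /eqP]; rewrite eq_sym posE; exists c.
apply: uniq_perm; rewrite ?map_inj_uniq ?enum_uniq //.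
- exact: pos_inj.
- by move=> [a b] [a' b'] [-> ->].
- exact: addIr.
move=> z; apply/mapP/idP => [[c + ->]|/mapP[_ /mapP[q qs ->] ->]].
  by rewrite mem_enum memD memE.
have [c cq] := onB q qs; exists c; last by apply/esym/eqP; rewrite posE.
by rewrite mem_enum memD; apply/hasP; exists q.
Qed.

(** Mapped into the integers, this is [L_tetrominoes] by conversion, in the form that
    [is_translateP] expects. *)
Definition shapes : seq (seq (nat * nat)) :=
  [:: [:: (0, 0); (0, 1); (0, 2); (1, 0)]; [:: (0, 0); (0, 1); (1, 1); (2, 1)];
      [:: (0, 0); (1, 0); (2, 0); (2, 1)]; [:: (0, 2); (1, 0); (1, 1); (1, 2)]].

(** The row bounds keep a shape within the 7 rows, and the last offset, being the largest, decides
    whether it stays within the [N] columns. *)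
Lemma is_tile_tile_at D :
  reflect (exists p t, [/\ t \in tiles, fits_row (p %% 7) t,
                           p + last 0 t.2 < 7 * N & D = tile_at p t.2])
          (is_tile D).
Proof.
have -> : is_tile D = [exists d : cell 7 N, has (fun s =>
    is_translate D [seq (q.1%:Z, q.2%:Z)%R | q <- s] (pos d)) shapes] by [].
apply: (iffP existsP) => [[d /hasP[s sL]]|[p [t [tT tr pt ->]]]].
  have s_uniq : uniq s by move: s sL; apply/allP.
  rewrite is_translateP // => -[onB memD].
  case: d onB memD => [[dx ltdx] [dy ltdy]] /=.
  move: sL {s_uniq}; rewrite !inE => /or4P[]/eqP-> onB memD.
  - exists (dx * 7 + dy), (0, 4, [:: 0; 1; 2; 7]).
    (* In each case the two chosen cells bound the row and the column of the corner. *)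
    have [[[? ?] [? ?]] /andP[/= ? ?]] := onB (0, 2) isT.
    have [[[? ?] [? ?]] /andP[/= ? ?]] := onB (1, 0) isT.
    split=> //; rewrite /fits_row /=; try lia.
    apply/setP=> -[[x ltx] [y lty]].
    rewrite memD !inE /shifted /rank /=; lia.
  - exists (dx * 7 + dy), (0, 5, [:: 0; 1; 8; 15]).
    have [[[? ?] [? ?]] /andP[/= ? ?]] := onB (0, 1) isT.
    have [[[? ?] [? ?]] /andP[/= ? ?]] := onB (2, 1) isT.
    split=> //; rewrite /fits_row /=; try lia.
    apply/setP=> -[[x ltx] [y lty]].
    rewrite memD !inE /shifted /rank /=; lia.
  - exists (dx * 7 + dy), (0, 5, [:: 0; 7; 14; 15]).
    have [[[? ?] [? ?]] /andP[/= ? ?]] := onB (2, 0) isT.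
    have [[[? ?] [? ?]] /andP[/= ? ?]] := onB (2, 1) isT.
    split=> //; rewrite /fits_row /=; try lia.
    apply/setP=> -[[x ltx] [y lty]].
    rewrite memD !inE /shifted /rank /=; lia.
  (* The first cell in column order is (0, 2), two rows above the corner. *)
  - exists (dx * 7 + dy + 2), (2, 6, [:: 0; 5; 6; 7]).
    have [[[? ?] [? ?]] /andP[/= ? ?]] := onB (0, 2) isT.
    have [[[? ?] [? ?]] /andP[/= ? ?]] := onB (1, 2) isT.
    split=> //; rewrite /fits_row /=; try lia.
    apply/setP=> -[[x ltx] [y lty]].
    rewrite memD !inE /shifted /rank /=; lia.
have onB (d : cell 7 N) (q : nat * nat) :
    q.2 + d.2 < 7 -> q.1 * 7 + q.2 + rank d < 7 * N ->
    exists c, shifted (d.1 : nat, d.2 : nat) q c.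
  case: d => [[dx ltdx] [dy ltdy]]; case: q => a b; rewrite /rank /= => lt7 ltN.
  have [c cE] := rank_surj ltN; exists c.
  case: c cE => [[x ltx] [y lty]]; rewrite /rank /shifted /=; lia.
move: tT tr pt; rewrite !inE => /or4P[]/eqP-> tr pt; rewrite /fits_row /= in tr pt.
- have [|[[dx ltdx] [dy ltdy]] dE] := @rank_surj (p - 0); first by lia.
  rewrite /rank /= in dE; exists (Ordinal ltdx, Ordinal ltdy).
  apply/hasP; exists [:: (0, 0); (0, 1); (0, 2); (1, 0)]; first by [].
  apply/is_translateP; first by [].
  split=> [q|[[x ltx] [y lty]]]; last by rewrite !inE /shifted /rank /=; lia.
  by rewrite !inE => /or4P[]/eqP->; apply: onB; rewrite /rank /=; lia.
- have [|[[dx ltdx] [dy ltdy]] dE] := @rank_surj (p - 0); first by lia.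
  rewrite /rank /= in dE; exists (Ordinal ltdx, Ordinal ltdy).
  apply/hasP; exists [:: (0, 0); (0, 1); (1, 1); (2, 1)]; first by [].
  apply/is_translateP; first by [].
  split=> [q|[[x ltx] [y lty]]]; last by rewrite !inE /shifted /rank /=; lia.
  by rewrite !inE => /or4P[]/eqP->; apply: onB; rewrite /rank /=; lia.
- have [|[[dx ltdx] [dy ltdy]] dE] := @rank_surj (p - 0); first by lia.
  rewrite /rank /= in dE; exists (Ordinal ltdx, Ordinal ltdy).
  apply/hasP; exists [:: (0, 0); (1, 0); (2, 0); (2, 1)]; first by [].
  apply/is_translateP; first by [].
  split=> [q|[[x ltx] [y lty]]]; last by rewrite !inE /shifted /rank /=; lia.
  by rewrite !inE => /or4P[]/eqP->; apply: onB; rewrite /rank /=; lia.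
- have [|[[dx ltdx] [dy ltdy]] dE] := @rank_surj (p - 2); first by lia.
  rewrite /rank /= in dE; exists (Ordinal ltdx, Ordinal ltdy).
  apply/hasP; exists [:: (0, 2); (1, 0); (1, 1); (1, 2)]; first by [].
  apply/is_translateP; first by [].
  split=> [q|[[x ltx] [y lty]]]; last by rewrite !inE /shifted /rank /=; lia.
  by rewrite !inE => /or4P[]/eqP->; apply: onB; rewrite /rank /=; lia.
Qed.
End Board.

(** * Correctness of the cell-by-cell count *)

Lemma clashP p s :
  reflect (exists i, nth false p i && nth false s i) (clash p s).
Proof.
apply: (iffP idP).
  elim: p s => //= b p IHp [|a s] /=.
    by rewrite andbF => /IHp[i]; rewrite nth_nil andbF.
  by case/orP=> [ba|/IHp[i pi]]; [exists 0|exists i.+1].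
case=> i; elim: p s i => [|b p IHp] [|a s] [|i] //=; rewrite ?nth_nil ?andbF //.
  by move->.
by move/IHp->; rewrite orbT.
Qed.

Lemma nth_overlay p s i : nth false (overlay p s) i = nth false p i || nth false s i.
Proof.
by elim: p s i => [|b p IHp] [|a s] [|i] //=; rewrite ?IHp ?nth_nil ?orbF.
Qed.

Lemma overhangP K s :
  reflect (exists2 i, K <= i & nth false s i) (has id (drop K s)).
Proof.
apply: (iffP (has_nthP false)) => [[i _]|[i leKi si]].
  by rewrite nth_drop; exists (K + i); rewrite ?leq_addr.
exists (i - K); last by rewrite nth_drop subnKC.
rewrite size_drop ltn_sub2r //; last first.
  by rewrite ltnNge; apply: contraTN si => ?; rewrite nth_default.
by rewrite (leq_ltn_trans leKi) // ltnNge; apply: contraTN si => ?; rewrite nth_default.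
Qed.

Lemma last_tile t i : t \in tiles -> i \in t.2 -> i <= last 0 t.2.
Proof.
by rewrite !inE => /or4P[]/eqP-> /=; rewrite !inE; lia.
Qed.

Lemma nth_tail_mask t i : t \in tiles -> nth false (tail_mask t.2) i = (i.+1 \in t.2).
Proof.
move=> tT; have [lti|lei] := ltnP i (last 0 t.2); first by rewrite nth_mkseq.
rewrite nth_default ?size_mkseq //; apply/esym/negbTE; apply: contraL lei => io.
by rewrite -ltnNge last_tile.
Qed.

Section BoardDP.
Variable N : nat.
Implicit Types (c : cell 7 N) (D : {set cell 7 N}).

(** [rank c + K - 7 * N] is the position of [c] among the last [K] cells; the first conjunct guards
    the truncated subtraction. *)
Definition region (K : nat) (s : seq bool) : {set cell 7 N} :=
  [set c | (7 * N <= rank c + K) && ~~ nth false s (rank c + K - 7 * N)].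

(** This lets a sum over encoded tiles be read as a sum over sets of cells. *)
Lemma tile_at_inj p t t' : t \in tiles -> t' \in tiles ->
  p + last 0 t.2 < 7 * N -> p + last 0 t'.2 < 7 * N ->
  tile_at N p t.2 = tile_at N p t'.2 -> t = t'.
Proof.
move=> tT tT' lt lt' eqD.
have mem i : p + i < 7 * N -> (i \in t.2) = (i \in t'.2).
  move=> lti; have [c cE] := rank_surj lti; move/setP/(_ c): eqD.
  by rewrite !inE cE !mem_map //; exact: addnI.
have mem_all i : (i \in t.2) = (i \in t'.2).
  apply/idP/idP => io.
    by rewrite -mem //; have := last_tile tT io; lia.
  by rewrite mem //; have := last_tile tT' io; lia.
move: tT tT' mem_all {lt lt' eqD mem}; rewrite !inE.
(* Offsets 1, 8 and 14 suffice to tell the four tiles apart. *)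
by move=> /or4P[]/eqP-> /or4P[]/eqP-> // eq_mem;
  move: (eq_mem 1) (eq_mem 8) (eq_mem 14); rewrite !inE.
Qed.

(** Induction on [K], with [num_partitions_rec] at the first cell when it is free: a tile of the
    region covering that cell has it as first cell. Used flags past the end mean that a tile sticks
    out, hence the value 0. *)
Lemma completionsE K s : K <= 7 * N ->
  completions K s =
    if has id (drop K s) then 0 else num_partitions (@is_tile 7 N) (region K s).
Proof.
elim: K s => [|K IHK] s ltK.
  rewrite drop0 /= (_ : region 0 s = set0) ?num_partitions0; first by case: has.
  by apply/setP=> c; rewrite !inE addn0 leqNgt ltn_rank.
rewrite [LHS]/=; case: ifP => s0.
  rewrite IHK 1?ltnW //; case: s s0 => //= _ s ->.
  rewrite (_ : region K s = region K.+1 (true :: s)) //.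
  apply/setP=> c; rewrite !inE addnS.
  have [leN|ltN] := leqP (7 * N) (rank c + K); first by rewrite leqW // subSn.
  have -> : (rank c + K).+1 - 7 * N = 0 by lia.
  by rewrite andbF.
(* The rank of the first of the last [K.+1] cells. *)
set p := 7 * N - K.+1.
have [u uE] : exists c : cell 7 N, rank c = p by apply: rank_surj; lia.
set R := region K.+1 s; pose s' := behead s.
pose mask (t : nat * nat * seq nat) := tail_mask t.2.
have rowE : row_of K = p %% 7 by rewrite /row_of /p; lia.
have overE : has id (drop K.+1 s) = has id (drop K s').
  by rewrite /s'; case: (s) => //= _ ?; rewrite drop_nil.
have memR c : (c \in R) = (p < rank c) && ~~ nth false s' (rank c - p.+1) || (rank c == p).
  rewrite inE /s' nth_behead; have [ltp|gtp|eqp] := ltngtP p (rank c).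
  - have -> : rank c + K.+1 - 7 * N = (rank c - p.+1).+1 by lia.
    by rewrite orbF; congr (_ && _); lia.
  - by rewrite leqNgt (_ : _ < _) //; lia.
  - have -> : rank c + K.+1 - 7 * N = 0 by lia.
    by rewrite nth0 s0 andbT; lia.
have uR : u \in R by rewrite memR uE eqxx orbT.
have maskT t i : t \in tiles -> nth false (mask t) i = (i.+1 \in t.2).
  exact: nth_tail_mask.
have tile0 t : t \in tiles -> 0 \in t.2.
  by rewrite !inE => /or4P[]/eqP->.
have mem_tile q t c :
    (rank c \in [seq q + i | i <- t]) = (q <= rank c) && (rank c - q \in t).
  apply/mapP/andP => [[i it ->]|[lep rt]]; first by rewrite leq_addr addKn.
  by exists (rank c - q); rewrite ?subnKC.
have overlayE t : t \in tiles ->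
    region K (overlay (mask t) s') = R :\: tile_at N p t.2.
  move=> tT; apply/setP=> c; rewrite in_setD memR !inE nth_overlay maskT // mem_tile.
  have [ltp|gtp|eqp] := ltngtP p (rank c).
  - have -> : rank c + K - 7 * N = rank c - p.+1 by lia.
    have -> : 7 * N <= rank c + K by lia.
    by rewrite orbF subnSK // negb_or.
  - by rewrite leqNgt (_ : _ < _) //; lia.
  - by rewrite leqNgt (_ : _ < _) ?eqp ?subnn ?tile0 //; lia.
have over_overlay t : t \in tiles -> ~~ has id (drop K s') ->
    has id (drop K (overlay (mask t) s')) = (7 * N <= p + last 0 t.2).
  move=> tT over; apply/overhangP/idP => [[i leKi]|leN].
    rewrite nth_overlay maskT // => /orP[/(last_tile tT)|si]; first lia.
    by case/overhangP: over; exists i.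
  (* Flag [i] of a mask stands for offset [i.+1], whence the predecessor. *)
  exists (last 0 t.2).-1; first lia.
  rewrite nth_overlay maskT // prednK; last lia.
  by rewrite (_ : _ \in _) //; move: tT; rewrite !inE => /or4P[]/eqP->.
have sub_tile t : t \in tiles -> p + last 0 t.2 < 7 * N ->
    (tile_at N p t.2 \subset R) = ~~ clash (mask t) s'.
  move=> tT ltN; apply/subsetP/idP => [tR|/clashP noclash c].
    apply/clashP => -[i /andP[]]; rewrite maskT // => it si.
    have [c cE] : exists c : cell 7 N, rank c = p + i.+1.
      by apply: rank_surj; have := last_tile tT it; lia.
    have := tR c; rewrite inE memR mem_tile cE leq_addr addKn it => /(_ isT).
    have -> : p + i.+1 - p.+1 = i by lia.
    by rewrite si andbF; lia.
  rewrite inE memR mem_tile; have [ltp|//|-> _] := ltngtP p (rank c); last by [].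
  rewrite orbF /= => rt; apply/negP => si; apply: noclash.
  by exists (rank c - p.+1); rewrite maskT // subnSK // rt.
rewrite /tails big_map big_filter overE; case: ifPn => over.
  (* Flags past the end survive every overlay, so all terms vanish. *)
  rewrite big1_seq // => t _; case: ifP => // _; rewrite IHK ?ifT //; last exact: ltnW.
  case/overhangP: over => [i Ki si].
  by apply/overhangP; exists i; rewrite ?nth_overlay ?si ?orbT.
pose good t := [&& fits_row (row_of K) t, ~~ clash (mask t) s' & p + last 0 t.2 < 7 * N].
pose placed := [seq tile_at N p t.2 | t <- tiles & good t].
have placed_uniq : uniq placed.
  rewrite map_inj_in_uniq ?filter_uniq // => t t'.
  rewrite !mem_filter => /andP[/and3P[_ _ lt] tT] /andP[/and3P[_ _ lt'] tT'].
  exact: tile_at_inj.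
transitivity (\sum_(D <- placed) num_partitions (@is_tile 7 N) (R :\: D)).
  rewrite big_map big_filter [LHS]big_mkcond [RHS]big_mkcond.
  apply: eq_big_seq => t tT; rewrite /good -/(mask t).
  case: fits_row => //=; case: clash => //=.
  (* Tiles sticking out contribute 0 by the induction hypothesis. *)
  by rewrite (IHK _ (ltnW ltK)) over_overlay // overlayE // leqNgt; case: ltnP.
rewrite big_uniq // (num_partitions_rec _ uR); apply: eq_bigl => D.
apply/mapP/and3P => [[t]|[/is_tile_tile_at[q [t [tT tr qt DE]]] uD DR]].
  rewrite mem_filter => /andP[/and3P[tr cl lt] tT] ->; split.
  - by apply/is_tile_tile_at; exists p, t; rewrite -rowE.
  - by rewrite inE mem_tile uE leqnn subnn tile0.
  - by rewrite sub_tile.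
(* A tile within [R] starts no earlier than [u], the cell of least rank in [R]. *)
have qp : q = p.
  have [|c cE] := @rank_surj N q; first by lia.
  have : c \in R by apply: (subsetP DR); rewrite DE inE mem_tile cE leqnn subnn tile0.
  by move: uD; rewrite DE inE mem_tile uE memR cE; lia.
rewrite {q}qp in tr qt DE; exists t => //.
by rewrite mem_filter /good rowE tr -sub_tile // -DE DR qt.
Qed.

Lemma num_tilings_completions : num_tilings 7 N = completions (7 * N) [::].
Proof.
rewrite completionsE //=; congr #|pred_of_set _|.
apply/setP=> P; rewrite !inE /is_tiling; congr (partition P _ && _).
by apply/setP=> c; rewrite !inE addnC leq_addr nth_nil.
Qed.
End BoardDP.

Local Open Scope ring_scope.

(** * Quotients of formal power series *)

Section PowerSeries.
Variable F : fieldType.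
Implicit Types f g h : fps F.

Definition truncation (m : nat) f : {poly F} := \poly_(i < m) f i.

(** Low coefficients of a product depend only on low coefficients of the factors, so the ring laws
    carry over from polynomials. *)
Lemma fps_mul_truncation m f g n : (n < m)%N ->
  fps_mul f g n = (truncation m f * truncation m g)`_n.
Proof.
move=> ltnm; rewrite coefM; apply: eq_bigr => i _.
by rewrite !coef_poly !ifT //; have := ltn_ord i; lia.
Qed.

Lemma fps_mulC f g : fps_mul f g =1 fps_mul g f.
Proof. by move=> n; rewrite !(@fps_mul_truncation n.+1) // mulrC. Qed.

Lemma fps_mulA f g h : fps_mul (fps_mul f g) h =1 fps_mul f (fps_mul g h).
Proof.
have truncM f' g' h' n :
    fps_mul (fps_mul f' g') h' n =
    (truncation n.+1 f' * truncation n.+1 g' * truncation n.+1 h')`_n.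
  rewrite coefM; apply: eq_bigr => i _; rewrite (@fps_mul_truncation n.+1) //.
  by rewrite coef_poly ifT // ltnS leq_subr.
by move=> n; rewrite truncM fps_mulC truncM -mulrA mulrC.
Qed.

Lemma eq_fps_mul f f' g g' :
  f =1 f' -> g =1 g' -> fps_mul f g =1 fps_mul f' g'.
Proof. by move=> ff gg n; apply: eq_bigr => i _; rewrite ff gg. Qed.

Lemma fps_mulf1 f : fps_mul f (fps_one F) =1 f.
Proof.
move=> n; rewrite /fps_mul big_ord_recr /= subnn /fps_one /fps_of_poly coefC mulr1.
by rewrite big1 ?add0r // => i _; rewrite coefC subn_eq0 leqNgt ltn_ord mulr0.
Qed.

Lemma fps_div_unique f g h : g 0%N != 0 -> fps_mul g f =1 h -> f =1 fps_div h g.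
Proof.
move=> g0 gf n; rewrite /fps_div -(eq_fps_mul gf (frefl (fps_inv g))).
rewrite (eq_fps_mul (fps_mulC g f) (frefl _)) fps_mulA.
by rewrite (eq_fps_mul (frefl f) (fps_mulfV g0)) fps_mulf1.
Qed.
End PowerSeries.

(** * The recurrence and the generating function *)

Lemma eval_completions0 t : eval t (completions 0) = weight0 t.
Proof.
elim: t => [v|l IHl r _] /=; first by rewrite mulr1.
by rewrite -IHl [X in _ + X](eval0 r) addr0.
Qed.

Definition state (m : nat) := iter m (run 56) (Leaf 1%ZZ).

Lemma a_state m q : (a_ (m + q))%:R = eval (state m) (completions (56 * q)).
Proof.
rewrite /a_ num_tilings_completions.
transitivity (eval (Leaf 1%ZZ) (completions (56 * (m + q)))).
  by rewrite mulnA [RHS]mul1r.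
(* Each step moves 56 cells from the part left to complete into the state. *)
elim: m q => [|m IHm] q //; rewrite addSnnS IHm /state iterS eval_run ?mulnS //.
by rewrite dvdn_mulr.
Qed.

Lemma eval_combine cs ts K : size cs = size ts ->
  eval (combine cs ts) (completions K) =
  \sum_(i < size cs) nth 0 cs i * eval (nth (Leaf 0) ts i) (completions K).
Proof.
elim: cs ts => [|c cs IHcs] [|t ts] //= => [_|[eq_sz]]; first by rewrite big_ord0.
rewrite eval_merge; last exact: padded_completions.
by rewrite eval_scale big_ord_recl IHcs.
Qed.

(** [behead] drops w_0; as [B_coefs] is by decreasing degree, b_26 meets w_1 and b_0 meets w_27. *)
Lemma null_combine_states : null (combine B_coefs (behead states)).
Proof. by vm_cast_no_check (erefl true). Qed.

Definition convolution (b a : seq Z) (n : nat) : Z :=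
  foldr (fun i z => Z.add (Z.mul (nth Z0 b i) (nth Z0 a (n - i))) z) Z0 (iota 0 n.+1).

Definition initial_terms :=
  [:: 1; 14; 511; 18826; 699540; 26023308; 968374240; 36035363996]%ZZ.

Definition weights := map weight0 states.

(** At [n] = 26 the right side is the default 0, since A has degree 25. *)
Lemma weights_convolution_check :
  all (fun n => Z.eqb (convolution (rev B_coefs) weights n)
                      (Z.opp (nth Z0 (rev A_coefs) n)))
      (iota 0 27).
Proof. by vm_cast_no_check (erefl true). Qed.

Lemma take_weights : take 8 weights = initial_terms.
Proof. by vm_cast_no_check (erefl initial_terms). Qed.

Lemma weights_convolution n : (n < 27)%N ->
  convolution (rev B_coefs) weights n = - nth 0 (rev A_coefs) n.
Proof.
move=> ltn; apply/Z.eqb_eq; move/allP: weights_convolution_check => check.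
by apply: (check n); rewrite mem_iota.
Qed.

Lemma size_states : size states = 28.
Proof. exact: size_traject. Qed.

Lemma nth_states i : (i < 28)%N -> nth (Leaf 0) states i = state i.
Proof.
by move=> lti; rewrite (set_nth_default (Leaf 1)) ?size_traject // nth_traject.
Qed.

Lemma nth_weights i : (i < 28)%N -> nth 0 weights i = (a_ i)%:R.
Proof.
move=> lti; rewrite (nth_map (Leaf 0)) ?size_states // nth_states //.
by rewrite -[i in RHS]addn0 a_state muln0 eval_completions0.
Qed.

Lemma convolution_B n :
  \sum_(i < n.+1) nth 0 (rev B_coefs) i * (a_ (n - i))%:R = - nth 0 (rev A_coefs) n.
Proof.
have [ltn|len] := ltnP n 27.
  rewrite -weights_convolution // /convolution.
  transitivity (\sum_(i <- iota 0 n.+1)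
     nth 0 (rev B_coefs) i * nth 0 weights (n - i)); last by rewrite unlock.
  rewrite -[iota 0 _]/(index_iota 0 n.+1) big_mkord; apply: eq_bigr => i _.
  by rewrite nth_weights //; lia.
rewrite [in RHS]nth_default ?oppr0; last exact: leq_trans len.
(* [B_coefs] has 27 entries, so the terms from index 27 on vanish. *)
rewrite -(subnK (leqW len : (27 <= n.+1)%N)) addnC big_split_ord /=.
rewrite [X in _ + X]big1 ?addr0; last first.
  by move=> i _; rewrite nth_default ?mul0r //= leq_addr.
(* The vanishing combination is evaluated with [n - 27] further blocks of 8 columns, where w_(27-i)
   yields [a_ (n - i)]. *)
rewrite -[RHS](@eval_null _ (completions (56 * (n - 27))) null_combine_states).
rewrite eval_combine // (reindex_inj rev_ord_inj); apply: eq_bigr => i _.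
congr (_ * _); first by rewrite nth_rev /= ?subSS ?subKn //; have := ltn_ord i; lia.
rewrite nth_behead nth_states -?a_state ?ltnS.
  by congr (a_ _)%:R => /=; have := ltn_ord i; lia.
by rewrite -ltnS ltn_ord.
Qed.

Lemma coef_poly_of_coefs s n :
  (poly_of_coefs s)`_n = (int_of_Z (nth 0 (rev s) n))%:~R.
Proof.
rewrite coef_Poly; have [ltn|len] := ltnP n (size (rev s)).
  by rewrite (nth_map 0).
by rewrite !nth_default ?size_map.
Qed.

Lemma rat_of_Z_sum n (b : 'I_n -> Z) (c : 'I_n -> nat) :
  (int_of_Z (\sum_(i < n) b i * (c i)%:R)%R)%:~R =
  \sum_(i < n) (int_of_Z (b i))%:~R * (c i)%:R :> rat.
Proof.
rewrite !rmorph_sum; apply: eq_bigr => i _.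
by rewrite !rmorphM /= !rmorph_nat.
Qed.

Lemma rat_of_ZN z : (int_of_Z (- z)%R)%:~R = - (int_of_Z z)%:~R :> rat.
Proof. by rewrite !rmorphN. Qed.

Theorem proposition8 :
  (tilings_gf =1 fps_div (fps_opp (fps_of_poly A_poly)) (fps_of_poly B_poly))
  /\ [seq Z.of_nat (a_ n) | n <- iota 0 8]
     = [:: 1; 14; 511; 18826; 699540; 26023308; 968374240; 36035363996]%ZZ.
Proof.
split; last first.
  rewrite -[RHS]take_weights; apply: (@eq_from_nth _ 0).
    by rewrite size_take !size_map size_states size_iota.
  move=> i; rewrite size_map size_iota => lti.
  rewrite (nth_map 0%N) ?size_iota // nth_iota // nth_take // nth_weights; last lia.
  by rewrite -(rmorph_nat Z.of_nat) natn.
apply: fps_div_unique; first by rewrite B_poly0.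
move=> n; rewrite /fps_opp /fps_of_poly (coef_poly_of_coefs A_coefs) -rat_of_ZN.
rewrite -convolution_B rat_of_Z_sum; apply: eq_bigr => i _.
by rewrite (coef_poly_of_coefs B_coefs).
Qed.
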